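(* Let $f,h:\mathbb{R}^N\to\mathbb{R}$ be smooth functions such that $\nabla h$ never vanishes on the set $\{h=0\}$. Suppose $\overline{\mathbf{x}}$ is an isolated local solution of the optimization problem $$\text{Minimize in }\mathbf{x}\in\mathbb{R}^N:\quad f(\mathbf{x})\quad\text{subject to}\quad h(\mathbf{x})=0,$$ and of the system of optimality conditions $$\nabla f(\mathbf{x})+\lambda\nabla h(\mathbf{x})=\mathbf{0},\quad h(\mathbf{x})=0,\quad\text{for some }\lambda\in\mathbb{R}.$$ Let $\Psi:\mathbb{R}^N\to\mathbb{R}^N$ be a smooth vector field such that: 1. $h\,(\Psi\cdot\nabla h)<0$ at all points with $h\neq0$ of a neighbourhood of $\{h=0\}$; 2. $\Psi\cdot\nabla f\le0$ wherever $h=0$; 3. at any point, $\Psi\cdot\nabla f=0$ and $h=0$ imply that $\nabla f$ and $\nabla h$ are parallel. Then integral curves of the dynamical system $\mathbf{x}'=\Psi(\mathbf{x})$ starting sufficiently close to $\overline{\mathbf{x}}$ converge to $\overline{\mathbf{x}}$, namely $$\lim_{t\to\infty}\mathbf{x}(t)=\overline{\mathbf{x}}$$ provided $\mathbf{x}(0)$ is sufficiently close to $\overline{\mathbf{x}}$.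
   Context: A local solution of the optimization problem is a local minimum of $f$ relative to the feasible set $\{h=0\}$. ''Isolated'' means that some neighbourhood of $\overline{\mathbf{x}}$ contains no other local solution of the problem and no other solution $\mathbf{x}$ of the optimality system. Standing assumption: the equilibria (zeros of $\Psi$) of the dynamical system $\mathbf{x}'=\Psi(\mathbf{x})$ are isolated. *)

(* Defs.v *)
From HB Require Import structures.
From mathcomp Require Import all_boot all_order all_algebra.
From mathcomp Require Import all_classical all_reals all_analysis.
Import Order.TTheory GRing.Theory Num.Theory.
Import numFieldNormedType.Exports.

Set Implicit Arguments.
Unset Strict Implicit.
Unset Printing Implicit Defensive.

Local Open Scope classical_set_scope.
Local Open Scope ring_scope.

(* [f] is of class C^(k+1) when it is differentiable and its differential
   [x |-> 'd f x] is of class C^k. The domain is finite-dimensional, so the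
   latter may be tested on each vector [v] separately. *)
Fixpoint class_C (R : realType) (N : nat) (W : normedModType R) (k : nat)
    (f : 'rV[R]_N -> W) : Prop :=
  match k with
  | 0 => continuous f
  | k'.+1 => (forall x, differentiable f x) /\
             (forall v, class_C k' (fun x => 'd f x v))
  end.

Definition smooth (R : realType) (N : nat) (W : normedModType R)
    (f : 'rV[R]_N -> W) : Prop :=
  forall k, class_C k f.

Definition gradient (R : realType) (N : nat) (f : 'rV[R]_N -> R)
    (x : 'rV[R]_N) : 'rV[R]_N :=
  \row_(i < N) 'D_(delta_mx 0 i) f x.

Definition dotp (R : realType) (N : nat) (u v : 'rV[R]_N) : R :=
  \sum_(i < N) u 0 i * v 0 i.

Definition parallel (R : realType) (N : nat) (u v : 'rV[R]_N) : Prop :=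
  exists a b : R, (a, b) <> (0, 0) /\ a *: u + b *: v = 0.

Definition local_solution (R : realType) (N : nat) (f h : 'rV[R]_N -> R)
    (x : 'rV[R]_N) : Prop :=
  h x = 0 /\ \forall y \near x, h y = 0 -> f x <= f y.

Definition optimality_system (R : realType) (N : nat) (f h : 'rV[R]_N -> R)
    (x : 'rV[R]_N) : Prop :=
  (exists lambda : R, gradient f x + lambda *: gradient h x = 0) /\ h x = 0.

Definition isolated_solution (R : realType) (N : nat) (f h : 'rV[R]_N -> R)
    (x : 'rV[R]_N) : Prop :=
  [/\ local_solution f h x,
      optimality_system f h x &
      \forall y \near x^', ~ local_solution f h y /\ ~ optimality_system f h y].

Definition isolated_equilibria (R : realType) (N : nat)
    (Psi : 'rV[R]_N -> 'rV[R]_N) : Prop :=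
  forall p, Psi p = 0 -> \forall y \near p^', Psi y <> 0.

(* Only the values of [x] on [J] are meaningful. *)
Definition integral_curve (R : realType) (N : nat)
    (Psi : 'rV[R]_N -> 'rV[R]_N) (J : set R) (x : R -> 'rV[R]_N) : Prop :=
  [/\ open J, is_interval J & forall t, J t -> is_derive t 1 x (Psi (x t))].

Definition maximal_integral_curve (R : realType) (N : nat)
    (Psi : 'rV[R]_N -> 'rV[R]_N) (J : set R) (x : R -> 'rV[R]_N) : Prop :=
  integral_curve Psi J x /\
  forall (K : set R) (y : R -> 'rV[R]_N), integral_curve Psi K y ->
    J `<=` K -> (forall t, J t -> y t = x t) -> K `<=` J.

(* Main.v *)
Require Import Defs.
From HB Require Import structures.
From mathcomp Require Import all_boot all_order all_algebra.
From mathcomp Require Import all_classical all_reals all_analysis.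
From mathcomp Require Import ring lra.
Import Order.TTheory GRing.Theory Num.Theory.
Import numFieldNormedType.Exports.

(** The pair (|h|, f) acts as a two-stage Lyapunov function near [xbar].

    Take a closed ball [B] around [xbar] of small radius. In [B], |h| cannot
    increase along an integral curve, since the derivative of h^2 is
    2 h (Psi . grad h). On [B] minus its center, at points where [h = 0], the
    rate Psi . grad f is strictly negative: if it vanished, grad f and
    grad h <> 0 would be parallel, so the point would solve the optimality
    system. At the same points f > f(xbar): a point with f <= f(xbar) would be
    another local solution. These facts are collected in [descent_ball]. By
    compactness ([uniform_negativity]) each strict inequality persists, with a
    margin, on the part of an annulus where |h| is merely small; this is what
    makes it possible to treat curves that never reach [{h = 0}].

    Stability ([descent_ball_stable]): a curve that starts very close to [xbar]
    keeps |h| small. To reach the sphere of radius [rho] it would have to bring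
    f from nearly f(xbar) up to a level definitely above f(xbar), but outside a
    smaller ball f decreases. Attraction: |h| tends to 0, because otherwise h^2
    would decrease at a uniform rate for ever ([constraint_vanishes]); once |h|
    is small, f decreases at a uniform rate as long as the curve avoids a given
    neighbourhood of [xbar], which cannot last ([descent_ball_approach]). Having
    entered a small ball, the curve is kept close to [xbar] by stability.

    A maximal curve that stays in a ball is defined for all positive times
    ([maximal_curve_global]): the Picard-Lindelof theorem, applied to [Psi] cut
    off outside a larger ball, gives an existence time that is the same at all
    points of the ball, so a curve with a finite end could be prolonged. *)

Set Implicit Arguments.
Unset Strict Implicit.
Unset Printing Implicit Defensive.

Local Open Scope classical_set_scope.
Local Open Scope ring_scope.

(** * Calculus along curves *)

Lemma coord_le_norm (R : realType) (N : nat) (v : 'rV[R]_N) (i : 'I_N) :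
  `|v 0 i| <= `|v|.
Proof.
by rewrite [leRHS]/Num.Def.normr/= mx_normrE; exact: (le_bigmax _ _ (0, i)).
Qed.

Lemma norm_le_coord (R : realType) (N : nat) (v : 'rV[R]_N) (C : R) :
  0 <= C -> (forall i, `|v 0 i| <= C) -> `|v| <= C.
Proof.
move=> C0 vC; rewrite [leLHS]/Num.Def.normr/= mx_normrE.
by apply: bigmax_le => // -[i j] _; rewrite (ord1 i); exact: vC.
Qed.

Lemma is_derive_coordP (R : realType) (N : nat) (x : R -> 'rV[R]_N)
    (v : 'rV[R]_N) (t : R) :
  is_derive t 1 x v <->
  forall i, is_derive t 1 (fun s => x s 0 i) (v 0 i).
Proof.
split=> [xv i|xv].
  have dx : derivable x t 1 by exact: ex_derive.
  apply: DeriveDef; first by move/derivable_mxP : dx => /(_ 0 i).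
  by have := derive_mx dx; rewrite derive_val => ->; rewrite mxE.
have dx : derivable x t 1.
  by apply/derivable_mxP => i j; rewrite (ord1 i); case: (xv j).
apply: DeriveDef => //; rewrite derive_mx//; apply/rowP => j.
by rewrite mxE; case: (xv j).
Qed.

Lemma is_derive_comp_curve (R : realType) (N : nat) (W : normedModType R)
    (g : 'rV[R]_N -> W) (x : R -> 'rV[R]_N) (v : 'rV[R]_N) (t : R) :
  differentiable g (x t) -> is_derive t 1 x v ->
  is_derive t 1 (g \o x) ('d g (x t) v).
Proof.
move=> dg xv.
have dx : differentiable x t by apply/derivable1_diffP; exact: ex_derive.
have dgx : differentiable (g \o x) t by exact: differentiable_comp.
apply: DeriveDef; first exact/derivable1_diffP.
rewrite deriveE// diff_comp//= -[in RHS](@derive_val _ _ _ _ _ _ _ xv).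
by rewrite (deriveE _ dx).
Qed.

Lemma curve_continuous (R : realType) (V : normedModType R) (x : R -> V)
    (v : V) (t : R) : is_derive t 1 x v -> {for t, continuous x}.
Proof.
by move=> ?; apply/differentiable_continuous/derivable1_diffP; exact: ex_derive.
Qed.

Lemma increment_le (R : realType) (u du : R -> R) (a b k : R) :
  a <= b -> (forall t, a <= t <= b -> is_derive t 1 u (du t)) ->
  (forall t, a <= t <= b -> du t <= k) -> u b - u a <= k * (b - a).
Proof.
move=> ab udu duk.
have [t tab|t tab|c cab ->] := @MVT_segment R u du a b ab.
- by apply: udu; move: tab; rewrite in_itv/= => /andP[/ltW-> /ltW->].
- suff : {within `[a, b], continuous u} by exact.
  apply: derivable_within_continuous => s; rewrite in_itv/= => /udu ?.
  exact: ex_derive.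
- by rewrite ler_wpM2r ?subr_ge0// duk//; move: cab; rewrite in_itv.
Qed.

(** The mean value theorem fails for vector-valued maps, but its inequality
    holds in each coordinate, hence in the maximum norm. *)
Lemma increment_norm_le (R : realType) (N : nat) (x dx : R -> 'rV[R]_N)
    (a b k : R) :
  a <= b -> (forall t, a <= t <= b -> is_derive t 1 x (dx t)) ->
  (forall t, a <= t <= b -> `|dx t| <= k) -> `|x b - x a| <= k * (b - a).
Proof.
move=> ab xdx dxk.
have k0 : 0 <= k by apply: le_trans (dxk a _); rewrite ?normr_ge0// lexx ab.
apply: norm_le_coord => [|i]; first by rewrite mulr_ge0// subr_ge0.
have dxi t : a <= t <= b -> `|dx t 0 i| <= k.
  by move=> tab; apply: le_trans (dxk _ tab); exact: coord_le_norm.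
have xdxi t : a <= t <= b -> is_derive t 1 (fun s => x s 0 i) (dx t 0 i).
  by move=> /xdx/is_derive_coordP; exact.
rewrite !mxE ler_norml; apply/andP; split.
  rewrite lerNl; have -> : - (x b 0 i - x a 0 i) =
    (- (fun s => x s 0 i)) b - (- (fun s => x s 0 i)) a
    by rewrite /= opprB !fctE opprK addrC.
  apply: (@increment_le _ _ (fun t => - dx t 0 i)) => // t tab.
    by have := xdxi t tab => ?; exact: is_deriveN.
  by rewrite lerNl; have := dxi t tab; rewrite ler_norml => /andP[].
apply: (@increment_le _ (fun s => x s 0 i) (fun t => dx t 0 i)) => // t tab.
by apply: le_trans (dxi _ tab); exact: ler_norm.
Qed.

(** Two-sided form of [increment_norm_le], for an interval centered at [a]. *)
Lemma increment_dist_le (R : realType) (N : nat) (x dx : R -> 'rV[R]_N)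
    (a r t k : R) :
  (forall s, `|s - a| <= r -> is_derive s 1 x (dx s)) ->
  (forall s, `|s - a| <= r -> `|dx s| <= k) ->
  `|t - a| <= r -> `|x t - x a| <= k * `|t - a|.
Proof.
move=> xdx dxk tar; have [at_|/ltW ta] := leP a t.
  rewrite (ger0_norm (_ : 0 <= t - a)) ?subr_ge0//.
  move: tar; rewrite ger0_norm ?subr_ge0// => tar.
  have near_a s : a <= s <= t -> `|s - a| <= r.
    by move=> /andP[? ?]; rewrite ger0_norm ?subr_ge0//; lra.
  by apply: (@increment_norm_le _ _ x dx) => // s /near_a; [exact: xdx|exact: dxk].
have ta' : `|t - a| = a - t by rewrite distrC ger0_norm ?subr_ge0.
rewrite distrC ta'; rewrite ta' in tar.
have near_a s : t <= s <= a -> `|s - a| <= r.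
  by move=> /andP[? ?]; rewrite distrC ger0_norm ?subr_ge0//; lra.
by apply: (@increment_norm_le _ _ x dx) => // s /near_a; [exact: xdx|exact: dxk].
Qed.

(** The primitive is an integral from [a - b], shifted by a constant; starting
    left of [a] makes it differentiable on both sides of [a]. *)
Lemma primitive_exists (R : realType) (g : R -> R) (a p b : R) :
  continuous g -> 0 < b -> exists2 G : R -> R, G a = p &
   forall t, `|t - a| < b -> is_derive t 1 G (g t).
Proof.
move=> cg b0.
pose F (x : R) := (\int[@lebesgue_measure R]_(t in [set` `[a - b, x]]) (g t))%R.
exists (fun t => F t - F a + p); first by rewrite subrr add0r.
move=> t tab.
have [tab1 tab2] : a - b < t /\ t < a + b by move: tab; rewrite ltr_norml; lra.
have ig : (@lebesgue_measure R).-integrable `[a - b, a + b] (EFin \o g).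
  apply: continuous_compact_integrable; first exact: segment_compact.
  by apply: continuous_subspaceT.
have [dF F't] := continuous_FTC1_closed tab2 ig tab1 (cg t).
rewrite derive1E in F't; have isF : is_derive t 1 F (g t) := DeriveDef dF F't.
have -> : (fun t => F t - F a + p) = F + (cst (p - F a)).
  by apply/funext => s /=; rewrite !fctE addrAC addrA.
by rewrite -[g t]addr0; apply: is_deriveD.
Qed.

(** * The Picard-Lindelof theorem *)

Definition clamp (R : realType) (lo hi t : R) : R :=
  Num.max lo (Num.min t hi).

Lemma clamp_itv (R : realType) (lo hi t : R) :
  lo <= hi -> lo <= clamp lo hi t <= hi.
Proof. by move=> lohi; rewrite /clamp le_max lexx ge_max lohi ge_min lexx orbT. Qed.

Lemma clamp_id (R : realType) (lo hi t : R) :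
  lo <= t <= hi -> clamp lo hi t = t.
Proof. by move=> /andP[lot thi]; rewrite /clamp min_l// max_r. Qed.

Lemma clamp_lipschitz (R : realType) (lo hi s t : R) :
  `|clamp lo hi s - clamp lo hi t| <= `|s - t|.
Proof.
wlog st : s t / s <= t => [W|].
  by have [/W//|/ltW /W] := leP s t; rewrite distrC (distrC t).
rewrite distrC (distrC s) (ger0_norm (_ : 0 <= t - s)) ?subr_ge0//.
rewrite /clamp; case: (leP s hi) => ?; case: (leP t hi) => ?;
  case: (leP lo s) => ?; case: (leP lo t) => ?; case: (leP lo hi) => ?;
  rewrite ger0_norm; lra.
Qed.

Lemma lipschitz_continuous (R : realType) (V W : normedModType R) (g : V -> W)
    (L : R) : (forall x y, `|g x - g y| <= L * `|x - y|) -> continuous g.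
Proof.
move=> gL x; apply/cvgrPdist_lt => e e0.
have L1 : 0 < `|L| + 1 by rewrite ltr_wpDl.
near=> y; apply: le_lt_trans (gL x y) _.
apply: (@le_lt_trans _ _ ((`|L| + 1) * `|x - y|)).
  by rewrite ler_wpM2r//; apply: le_trans (ler_norm _) _; rewrite lerDl.
rewrite mulrC -ltr_pdivlMr//.
suff : ball x (e / (`|L| + 1)) y by rewrite -ball_normE.
by near: y; apply: nbhsx_ballx; rewrite divr_gt0.
Unshelve. all: by end_near. Qed.

Lemma half_power_small (R : realType) (C e : R) :
  0 < e -> exists n, C / 2 ^+ n < e.
Proof.
move=> e0; pose m := Num.bound `|C / e|; exists m.
rewrite ltr_pdivrMr ?exprn_gt0// mulrC -ltr_pdivrMr//.
apply: le_lt_trans (ler_norm _) _.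
have : `|C / e| < m%:R by apply: archi_boundP.
by move/lt_le_trans; apply; rewrite -natrX ler_nat; apply: ltnW; exact: ltn_expl.
Qed.

(** Telescoping bounds the distance from [u n] to all later terms by the tail
    of a geometric series, so the sequence is Cauchy and the bound passes to the
    limit. *)
Lemma geometric_steps_cvg (R : realType) (N : nat)
    (u : nat -> 'rV[R]_N) (C : R) :
  (forall n, `|u n.+1 - u n| <= C / 2 ^+ n) ->
  exists l, forall n, `|l - u n| <= 2 * C / 2 ^+ n.
Proof.
move=> uC.
have C0 : 0 <= C by have := uC 0%N; rewrite expr0 divr1; exact: le_trans.
have tele n m : `|u (n + m)%N - u n| <= 2 * C / 2 ^+ n.
  (* The sharper bound, with the remaining tail subtracted, is inductive. *)
  suff : `|u (n + m)%N - u n| <= 2 * C / 2 ^+ n - 2 * C / 2 ^+ (n + m).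
    by move/le_trans; apply; rewrite lerBlDr lerDl divr_ge0 ?mulr_ge0 ?exprn_ge0.
  elim: m => [|m ih]; first by rewrite addn0 !subrr normr0.
  have := uC (n + m)%N; rewrite addnS exprS => un.
  apply: (le_trans (ler_distD (u (n + m)%N) _ _)).
  have -> : 2 * C / (2 * 2 ^+ (n + m)) = C / 2 ^+ (n + m).
    by rewrite invfM mulrACA divff// mul1r.
  move: un ih; rewrite -(mulrA 2 C (2 ^+ (n+m))^-1); lra.
have cu : cvgn u.
  apply/cauchy_cvgP/cauchyP => e e0.
  have [n Cn] := half_power_small (2 * C) e0.
  exists (u n); suff : \forall m \near \oo, ball (u n) e (u m) by [].
  near=> m; rewrite -ball_normE /= distrC.
  have nm : (n <= m)%N by near: m; exists n.
  by rewrite -(subnKC nm); apply: le_lt_trans (tele _ _) _.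
exists (limn u) => n; apply/ler_addgt0Pr => e e0.
near \oo => m; rewrite [leRHS]addrC.
apply: le_trans (ler_distD (u m) _ _) _; apply: lerD.
  by apply: ltW; near: m; exact: cvgr_dist_lt.
have nm : (n <= m)%N by near: m; exists n.
by rewrite -(subnKC nm); exact: tele.
Unshelve. all: by end_near. Qed.

Lemma primitive_curve_exists (R : realType) (N : nat) (g : R -> 'rV[R]_N)
    (a b : R) (p : 'rV[R]_N) :
  continuous g -> 0 < b -> exists2 G : R -> 'rV[R]_N, G a = p &
   forall t, `|t - a| < b -> is_derive t 1 G (g t).
Proof.
move=> cg b0.
have /choice[G GE] (i : 'I_N) : exists G : R -> R, G a = p 0 i /\
    forall t, `|t - a| < b -> is_derive t 1 G (g t 0 i).
  have cgi : continuous (fun t => g t 0 i).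
    move=> t; exact: (@continuous_comp _ _ _ g (fun v : 'rV[R]_N => v 0 i) t
      (cg t) (@coord_continuous R 1 N 0 i (g t))).
  by have [G] := primitive_exists a (p 0 i) cgi b0; exists G.
exists (fun t => \row_i G i t); first by apply/rowP => i; rewrite mxE (GE i).1.
move=> t tab; apply/is_derive_coordP => i.
have -> : (fun s => (\row_i G i s) 0 i) = G i by apply/funext => s; rewrite mxE.
exact: (GE i).2.
Qed.

(** Picard iteration. Time is clamped to [[a - tau, a + tau]] before the iterates
    are evaluated, so that they are defined and continuous on the whole line while
    the bound [L * tau <= 1 / 2] makes each iteration halve uniform distances. The
    uniform limit is the fixed point. The map [P] picks a primitive of [F \o w], and
    every estimate on it goes through its derivative. *)
Lemma picard_lindelof (R : realType) (N : nat) (F : 'rV[R]_N -> 'rV[R]_N)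
    (L tau a : R) (p : 'rV[R]_N) :
  (forall x y, `|F x - F y| <= L * `|x - y|) ->
  0 < tau -> 0 <= L -> L * tau <= 1 / 2 ->
  exists2 z : R -> 'rV[R]_N, z a = p &
    forall t, `|t - a| < tau -> is_derive t 1 z (F (z t)).
Proof.
move=> FL tau0 L0 Ltau.
have cF : continuous F by exact: lipschitz_continuous FL.
have /choice[P PE] (w : R -> 'rV[R]_N) : exists G : R -> 'rV[R]_N,
    continuous w -> G a = p /\
      forall t, `|t - a| <= tau -> is_derive t 1 G (F (w t)).
  have [cw|] := pselect (continuous w); last by move=> ?; exists w.
  have cFw : continuous (F \o w).
    by move=> t; apply: continuous_comp; [exact: cw|exact: cF].
  (* Twice the radius makes the primitive differentiable up to the end points
     [a - tau] and [a + tau]. *)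
  have tau2 : 0 < tau * 2 by rewrite mulr_gt0.
  have [G Ga GF] := @primitive_curve_exists R N (F \o w) a _ p cFw tau2.
  exists G => _; split=> // t ta; apply: GF; lra.
pose c := clamp (a - tau) (a + tau).
have ca t : `|c t - a| <= tau.
  have : a - tau <= c t <= a + tau by apply: clamp_itv; lra.
  by rewrite ler_norml; lra.
have cc : continuous c.
  apply: (@lipschitz_continuous _ R R _ 1) => s t.
  by rewrite mul1r; exact: clamp_lipschitz.
pose W w := P w \o c.
have cW (w : R -> 'rV[R]_N) : continuous w -> continuous (W w).
  move=> cw t; apply: continuous_comp; first exact: cc.
  exact: (curve_continuous ((PE w cw).2 _ (ca t))).
have Wcontr (w w' : R -> 'rV[R]_N) C : continuous w -> continuous w' ->
    (forall t, `|w t - w' t| <= C) -> forall t, `|W w t - W w' t| <= C / 2.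
  move=> cw cw' ww' t.
  have C0 : 0 <= C by apply: le_trans (ww' 0).
  have [Pa Pd] := PE w cw; have [Pa' Pd'] := PE w' cw'.
  have := @increment_dist_le R N (P w - P w') (fun t => F (w t) - F (w' t))
    a tau (c t) (L * C).
  rewrite !fctE Pa Pa' subrr subr0 => /(_ _ _ (ca t)) H.
  apply: (le_trans (H _ _)).
  - by move=> s sa; apply: is_deriveB; [exact: Pd|exact: Pd'].
  - by move=> s sa; apply: le_trans (FL _ _) _; rewrite ler_wpM2l.
  apply: (@le_trans _ _ (L * C * tau)); first by rewrite ler_wpM2l ?mulr_ge0.
  by rewrite mulrAC; have := ler_wpM2r C0 Ltau; rewrite mul1r (mulrC C).
pose w := fix w n := if n is n'.+1 then W (w n') else cst p.
have cw n : continuous (w n) by elim: n => [|n ih]; [exact: cst_continuous|exact: cW].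
pose C := `|F p| * tau.
have wstep n t : `|w n.+1 t - w n t| <= C / 2 ^+ n.
  elim: n t => [t|n ih t]; last first.
    rewrite exprSr invfM mulrA.
    exact: (@Wcontr (w n.+1) (w n) _ (cw _) (cw _)).
  have [Pa Pd] := PE _ (cw 0%N).
  have := @increment_dist_le R N _ _ a tau (c t) `|F p| Pd (fun _ _ => lexx _) (ca t).
  rewrite Pa => /le_trans; rewrite expr0 divr1; apply.
  by rewrite ler_wpM2l.
have /choice[z zE] t := @geometric_steps_cvg R N (w ^~ t) C (wstep ^~ t).
have cz : continuous z.
  move=> t; apply/cvgrPdist_lt => e e0.
  have e3 : 0 < e / 3 by rewrite divr_gt0.
  have [n Cn] := half_power_small (2 * C) e3.
  near=> s.
  have ts : `|w n t - w n s| < e / 3.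
    by near: s; apply: cvgr_dist_lt e3; exact: cw.
  have := zE t n; have := zE s n; rewrite (distrC (z s)) => zs zt.
  apply: (le_lt_trans (ler_distD (w n t) _ _)).
  have := ler_distD (w n s) (w n t) (z s); lra.
(* [W z] and [z] are both within a multiple of 2^-n of the iterate [n.+1]. *)
have Wz t : W z t = z t.
  apply/eqP; rewrite -subr_eq0 -normr_le0; apply/ler_addgt0Pl => e e0; rewrite addr0.
  have [n Cn] := half_power_small (2 * C) e0.
  have W1 : `|W z t - w n.+1 t| <= 2 * C / 2 ^+ n / 2.
    by apply: Wcontr => // s; exact: zE.
  have := zE t n.+1; rewrite exprSr invfM mulrA distrC => W2.
  apply: (le_trans (ler_distD (w n.+1 t) _ _)); lra.
have [Pa Pd] := PE z cz.
exists (P z) => // t ta; rewrite [P z t](_ : _ = z t); first exact: Pd (ltW ta).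
rewrite -Wz /W /= [c t]clamp_id//; move: ta; rewrite ltr_norml; lra.
Unshelve. all: by end_near. Qed.

(** * Smooth functions and compact sets *)

Lemma continuous_finite_sum (R : realType) (T : topologicalType) (N : nat)
    (g : 'I_N -> T -> R) :
  (forall i, continuous (g i)) -> continuous (fun x => \sum_i g i x).
Proof.
move=> cg; elim: (index_enum _) => [|i s ih] x.
  have -> : (fun x => \sum_(i <- [::]) g i x) = cst 0.
    by apply/funext => y; rewrite big_nil.
  exact: cst_continuous.
have -> : (fun x => \sum_(i <- i :: s) g i x) =
    g i \+ (fun x => \sum_(i <- s) g i x).
  by apply/funext => y; rewrite big_cons.
by apply: continuousD; [exact: cg|exact: ih].
Qed.

Lemma derivative_sum (R : realType) (N : nat) (W : normedModType R)
    (g : 'rV[R]_N -> W) (x v : 'rV[R]_N) :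
  'd g x v = \sum_i v 0 i *: 'd g x (delta_mx 0 i).
Proof.
by rewrite [in LHS](row_sum_delta v) linear_sum; apply: eq_bigr => i _; rewrite linearZ.
Qed.

Lemma derivative_gradient (R : realType) (N : nat) (g : 'rV[R]_N -> R)
    (x v : 'rV[R]_N) :
  differentiable g x -> 'd g x v = dotp v (gradient g x).
Proof.
move=> dg; rewrite derivative_sum; apply: eq_bigr => i _.
by rewrite /gradient mxE deriveE.
Qed.

Lemma smooth_differentiable (R : realType) (N : nat) (W : normedModType R)
    (g : 'rV[R]_N -> W) : smooth g -> forall x, differentiable g x.
Proof. by move=> /(_ 1%N)[]. Qed.

Lemma smooth_continuous (R : realType) (N : nat) (W : normedModType R)
    (g : 'rV[R]_N -> W) : smooth g -> continuous g.
Proof. by move=> /(_ 0%N). Qed.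

Lemma derivative_continuous (R : realType) (N : nat) (W : normedModType R)
    (g : 'rV[R]_N -> W) (v : 'rV[R]_N) :
  smooth g -> continuous (fun x => 'd g x v).
Proof. by move=> /(_ 1%N)[_]; exact. Qed.

Lemma rate_continuous (R : realType) (N : nat) (g : 'rV[R]_N -> R)
    (Psi : 'rV[R]_N -> 'rV[R]_N) :
  smooth g -> continuous Psi -> continuous (fun x => dotp (Psi x) (gradient g x)).
Proof.
move=> gS cPsi; apply: continuous_finite_sum => i x; apply: continuousM.
  exact: (@continuous_comp _ _ _ Psi (fun v : 'rV[R]_N => v 0 i) x (cPsi x)
    (@coord_continuous R 1 N 0 i (Psi x))).
have -> : (fun x => gradient g x 0 i) = (fun x => 'd g x (delta_mx 0 i)).
  by apply/funext => y; rewrite mxE deriveE//; exact: smooth_differentiable.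
exact: derivative_continuous.
Qed.

Lemma is_derive_along_curve (R : realType) (N : nat) (g : 'rV[R]_N -> R)
    (Psi : 'rV[R]_N -> 'rV[R]_N) (J : set R) (x : R -> 'rV[R]_N) (t : R) :
  smooth g -> integral_curve Psi J x -> J t ->
  is_derive t 1 (g \o x) (dotp (Psi (x t)) (gradient g (x t))).
Proof.
move=> gS [_ _ xPsi] Jt; have dg := smooth_differentiable gS.
by rewrite -derivative_gradient//; apply: is_derive_comp_curve => //; exact: xPsi.
Qed.

Lemma dist_continuous (R : realType) (N : nat) (a : 'rV[R]_N) :
  continuous (fun y : 'rV[R]_N => `|y - a|).
Proof.
apply: (@lipschitz_continuous R 'rV[R]_N R _ 1) => y z.
by rewrite mul1r (le_trans (ler_dist_dist _ _))// opprB addrA subrK.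
Qed.

Lemma annulus_compact (R : realType) (N : nat) (a : 'rV[R]_N) (r1 r2 : R) :
  compact [set y | r1 <= `|y - a| <= r2].
Proof.
apply: bounded_closed_compact.
  exists (r2 + `|a|); split; first exact: num_real.
  move=> M rM y /= /andP[_ yr]; apply/ltW; apply: le_lt_trans rM.
  by rewrite -[y](subrK a); apply: le_trans (ler_normD _ _) _; rewrite lerD2r.
have cn := @dist_continuous R N a.
rewrite (_ : mkset _ = (fun y : 'rV[R]_N => `|y - a|) @^-1` `[r1, r2]%classic).
  by apply: preimage_closed; [move=> y _; exact: cn|exact: itv_closed].
by apply/seteqP; split=> y /=; rewrite in_itv.
Qed.

(** The continuous function [min (G, - |h|)] is negative everywhere on [K]: at a
    zero of [h] because of [G], elsewhere because of [h]. Its maximum is [- c], and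
    where |h| < c the minimum can only be as small as [- c] through [G]. *)
Lemma uniform_negativity (R : realType) (T : topologicalType) (K : set T)
    (h G : T -> R) :
  compact K -> continuous h -> continuous G ->
  (forall x, K x -> h x = 0 -> G x < 0) ->
  exists2 c : R, 0 < c & forall x, K x -> `|h x| < c -> G x <= - c.
Proof.
move=> cK ch cG neg.
have [K0|/set0P/negP/negPn/eqP K0] := pselect (K !=set0); last first.
  by exists 1 => // x; rewrite K0.
pose phi x := Num.min (G x) (- `|h x|).
have cphi : continuous phi.
  move=> x; apply: (@continuous_min R T G (fun y => - `|h y|)); first exact: cG.
  by apply: cvgN; apply: cvg_norm; exact: ch.
have [m mK mmax] := compact_EVT_max K0 cK (continuous_subspaceT cphi).
have {}mK : K m by rewrite inE in mK.
exists (- phi m).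
  rewrite oppr_gt0 /phi; have [hm0|hm0] := eqVneq (h m) 0.
    by rewrite gt_min neg.
  by rewrite gt_min oppr_lt0 normr_gt0 hm0 orbT.
move=> x Kx hx; rewrite opprK; have := mmax x; rewrite inE => /(_ Kx).
by rewrite {1}/phi ge_min => /orP[//|]; lra.
Qed.

Lemma bounded_above_on_compact (R : realType) (T : topologicalType)
    (K : set T) (g : T -> R) :
  compact K -> continuous g ->
  exists2 C : R, 0 <= C & forall x, K x -> g x <= C.
Proof.
move=> cK cg.
have [K0|/set0P/negP/negPn/eqP K0] := pselect (K !=set0); last first.
  by exists 0 => // x; rewrite K0.
have [m _ mmax] := compact_EVT_max K0 cK (continuous_subspaceT cg).
exists `|g m| => // x Kx; apply: le_trans (ler_norm _).
by apply: mmax; rewrite inE.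
Qed.

(** The partial derivatives are bounded on the compact ball, and the ball is
    convex, so the bound can be integrated along the segment from [y] to [x]. *)
Lemma locally_lipschitz (R : realType) (N : nat)
    (Psi : 'rV[R]_N -> 'rV[R]_N) (a : 'rV[R]_N) (r : R) :
  smooth Psi -> exists2 L : R, 0 <= L &
    forall x y : 'rV[R]_N, `|x - a| <= r -> `|y - a| <= r ->
      `|Psi x - Psi y| <= L * `|x - y|.
Proof.
move=> PsiS.
have cd (i : 'I_N) : continuous (fun x => `|'d Psi x (delta_mx 0 i)|).
  by move=> x; exact: (cvg_norm (@derivative_continuous R N _ Psi (delta_mx 0 i) PsiS x)).
have /choice[C CE] (i : 'I_N) : exists C : R, 0 <= C /\
    forall x, `|x - a| <= r -> `|'d Psi x (delta_mx 0 i)| <= C.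
  have [C C0 CK] := bounded_above_on_compact (@annulus_compact R N a 0 r) (cd i).
  by exists C; split=> // x xr; apply: CK; rewrite /= normr_ge0.
have L0 : 0 <= \sum_i C i by apply: sumr_ge0 => i _; exact: (CE i).1.
exists (\sum_i C i) => // x y xa ya.
pose w (s : R) : 'rV[R]_N := y + s *: (x - y).
have dw (s : R) : is_derive s 1 w (x - y).
  apply/is_derive_coordP => i.
  have -> : (fun u => w u 0 i) = cst (y 0 i) + ((x - y) 0 i) *: (@id R).
    by apply/funext => u; rewrite !fctE /w !mxE mulrC.
  have dlin : is_derive s 1 (cst (y 0 i) + ((x - y) 0 i) *: (@id R))
      (0 + (x - y) 0 i *: 1).
    apply: is_deriveD; apply: is_deriveZ.
  by rewrite add0r [X in is_derive _ _ _ X]mulr1 in dlin.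
have wa (s : R) : 0 <= s <= 1 -> `|w s - a| <= r.
  move=> /andP[s0 s1].
  have -> : w s - a = (1 - s) *: (y - a) + s *: (x - a).
    by rewrite /w scalerBl scale1r !scalerBr; apply/rowP => i; rewrite !mxE; ring.
  apply: le_trans (ler_normD _ _) _; rewrite !normrZ (ger0_norm s0).
  rewrite ger0_norm ?subr_ge0//.
  have -> : r = (1 - s) * r + s * r by ring.
  by apply: lerD; apply: ler_wpM2l => //; rewrite subr_ge0.
have dPw (s : R) : 0 <= s <= 1 -> is_derive s 1 (Psi \o w) ('d Psi (w s) (x - y)).
  by move=> _; apply: is_derive_comp_curve => //; exact: smooth_differentiable.
have := @increment_norm_le R N _ _ 0 1 ((\sum_i C i) * `|x - y|) ler01 dPw.
rewrite /= /w scale1r scale0r addr0 subr0 mulr1.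
rewrite (addrC y) subrK; apply => s s01.
rewrite derivative_sum (le_trans (ler_norm_sum _ _ _))// mulr_suml.
apply: ler_sum => i _; rewrite normrZ mulrC.
by apply: ler_pM => //; [exact: (CE i).2 (wa _ s01)|exact: coord_le_norm].
Qed.

(** * Scalar comparison arguments *)

(** The times at which [n >= r] form a compact set, whose least element is [T]; by the
    intermediate value theorem the level is attained there exactly. Continuity is
    only known on [[a, b]]: composing [n] with [clamp a b] extends it to the line. *)
Lemma first_hit (R : realType) (n : R -> R) (a b r : R) :
  a <= b -> (forall t, a <= t <= b -> {for t, continuous n}) ->
  n a < r -> r <= n b ->
  exists T, [/\ a <= T <= b, n T = r & forall t, a <= t <= T -> n t <= r].
Proof.
move=> ab cn nar rnb.
have cc : continuous (clamp a b).
  apply: (@lipschitz_continuous _ R R _ 1) => s t.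
  by rewrite mul1r; exact: clamp_lipschitz.
have cnc : continuous (n \o clamp a b).
  move=> t; apply: continuous_comp; first exact: cc.
  by apply: cn; exact: clamp_itv.
pose S := `[a, b] `&` (n \o clamp a b) @^-1` `[r, +oo[.
have SE t : S t <-> a <= t <= b /\ r <= n t.
  rewrite /S /= !in_itv/= andbT; split=> -[tab]; rewrite ?(clamp_id tab)//.
have cS : compact S.
  apply: compact_closedI; first exact: segment_compact.
  by apply: preimage_closed; [move=> t _; exact: cnc|exact: interval_closed].
have [||T TS Tmin] := @compact_EVT_min R R id S _ cS.
- by exists b; apply/SE; rewrite ab lexx.
- by apply: continuous_subspaceT => t; exact: cvg_id.
have /SE[Tab rnT] : S T by rewrite inE in TS.
have Tfirst t : a <= t <= b -> r <= n t -> T <= t.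
  by move=> tab rnt; apply: Tmin; rewrite inE; apply/SE.
have [aT Tb] := andP Tab.
have [||c caT nc] := @IVT R n a T r aT.
- apply: continuous_in_subspaceT => t; rewrite inE/= in_itv/= => /andP[at_ tT].
  by apply: cn; rewrite at_ (le_trans tT).
- by rewrite ge_min (ltW nar) le_max rnT orbT.
move: caT; rewrite in_itv/= => /andP[ac cT].
exists T; split=> //.
  suff -> : T = c by [].
  by apply/eqP; rewrite eq_le cT Tfirst// ?nc// ac (le_trans cT).
move=> t /andP[at_ tT]; rewrite leNgt; apply/negP => rnt.
have /Tfirst Tt : a <= t <= b by rewrite at_ (le_trans tT).
have tE : t = T by apply/eqP; rewrite eq_le tT Tt// ltW.
have cE : c = T by apply/eqP; rewrite eq_le cT Tfirst ?nc// ac (le_trans cT).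
by move: rnt; rewrite tE -cE nc ltxx.
Qed.

(** If [u b > c], there is a last time at which [u = c]; after it [u >= c], hence
    [u] does not increase, which contradicts [u b > c]. That last time is the first
    hitting time of the reversed function [t |-> - u (- t)]. *)
Lemma barrier (R : realType) (u du : R -> R) (a b c : R) :
  a <= b -> (forall t, a <= t <= b -> is_derive t 1 u (du t)) ->
  u a <= c -> (forall t, a <= t <= b -> c <= u t -> du t <= 0) -> u b <= c.
Proof.
move=> ab udu uac duc; rewrite leNgt; apply/negP => cub.
have cu t : a <= t <= b -> {for t, continuous u}.
  by move=> /udu; exact: curve_continuous.
have [|t|||T [/andP[bT Ta] uT umin]] :=
  @first_hit R (fun t => - u (- t)) (- b) (- a) (- c).
- by rewrite lerN2.
- rewrite lerNl lerNr => /andP[bt ta].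
  apply: continuousN.
  apply: (@continuous_comp _ _ _ -%R u); first exact: oppr_continuous.
  by apply: cu; rewrite bt ta.
- by rewrite opprK ltrN2.
- by rewrite opprK lerN2.
have [aT Tb] : a <= - T /\ - T <= b by rewrite lerNr lerNl.
have ineq t : - T <= t <= b -> a <= t <= b /\ c <= u t.
  move=> /andP[Tt tb]; split; first by rewrite tb (le_trans aT).
  have : - u (- - t) <= - c by apply: umin; rewrite lerN2 tb lerNl.
  by rewrite opprK lerN2.
have := @increment_le R u du (- T) b 0 Tb.
rewrite mul0r => H.
have : u b - u (- T) <= 0.
  by apply: H => t /ineq[tab ct]; [exact: udu|exact: duc].
by move: uT => /oppr_inj ->; rewrite subr_le0 leNgt cub.
Qed.

Lemma no_perpetual_descent (R : realType) (u du : R -> R) (a k m : R) :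
  0 < k -> (forall t, a <= t -> is_derive t 1 u (du t)) ->
  (forall t, a <= t -> du t <= - k) -> ~ (forall t, a <= t -> m <= u t).
Proof.
move=> k0 udu duk mu; pose t := a + ((u a - m) / k + 1).
have at_ : a <= t.
  by rewrite lerDl addr_ge0// divr_ge0 ?(ltW k0)// subr_ge0; exact: mu.
have : u t - u a <= - k * (t - a).
  by apply: (@increment_le R u du) => // s /andP[? _]; [exact: udu|exact: duk].
have -> : - k * (t - a) = m - u a - k.
  by rewrite /t; field; rewrite gt_eqF.
have := mu t at_; lra.
Qed.

(** * Uniqueness and continuation of integral curves *)

(** On so short an interval, the largest distance between the two solutions is
    at most half of itself. *)
Lemma solution_unique (R : realType) (N : nat) (F : 'rV[R]_N -> 'rV[R]_N)
    (L s t : R) (x z : R -> 'rV[R]_N) :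
  (forall y y', `|F y - F y'| <= L * `|y - y'|) ->
  0 <= L -> s <= t -> L * (t - s) <= 1 / 2 ->
  (forall u, s <= u <= t -> is_derive u 1 x (F (x u))) ->
  (forall u, s <= u <= t -> is_derive u 1 z (F (z u))) ->
  x s = z s -> x t = z t.
Proof.
move=> FL L0 st Lst xF zF xzs.
have dxz (u : R) : s <= u <= t -> is_derive u 1 (x - z) (F (x u) - F (z u)).
  by move=> ust; apply: is_deriveB; [exact: xF|exact: zF].
have [|m mst mmax] := @EVT_max R (fun u => `|(x - z) u|) s t st.
  apply: continuous_in_subspaceT => u; rewrite inE/= in_itv/= => /dxz xzu.
  exact: (cvg_norm (curve_continuous xzu)).
have dist_s u : s <= u <= t -> `|(x - z) u| <= `|(x - z) m|.
  by move=> ust; apply: mmax; rewrite in_itv.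
move: mst; rewrite in_itv/= => /andP[sm mt].
have : `|(x - z) m - (x - z) s| <= L * `|(x - z) m| * (m - s).
  apply: (@increment_norm_le R N (x - z) (fun u => F (x u) - F (z u))) => //
    u /andP[su um].
    by apply: dxz; rewrite su (le_trans um).
  apply: le_trans (FL _ _) _; rewrite ler_wpM2l//.
  by apply: dist_s; rewrite su (le_trans um).
rewrite [(x - z) s](_ : _ = 0); last by rewrite !fctE xzs subrr.
rewrite subr0 mulrAC => xzm.
have : L * (m - s) * `|(x - z) m| <= 1 / 2 * `|(x - z) m|.
  rewrite ler_wpM2r//; apply: le_trans Lst.
  by rewrite ler_wpM2l// lerD2r.
have := dist_s t; rewrite st lexx => /(_ isT) xzt Hm.
have : `|(x - z) t| <= 0 by lra.
by rewrite normr_le0 subr_eq0 => /eqP.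
Qed.

(** For the maximum norm this is a retraction onto the closed ball of center [a]
    and radius [r], and it is 1-Lipschitz; composing a locally Lipschitz field with
    it yields a globally Lipschitz one. *)
Definition clamp_ball (R : realType) (N : nat) (a : 'rV[R]_N) (r : R)
    (y : 'rV[R]_N) : 'rV[R]_N :=
  \row_i clamp (a 0 i - r) (a 0 i + r) (y 0 i).

Lemma clamp_ball_in (R : realType) (N : nat) (a : 'rV[R]_N) (r : R) y :
  0 <= r -> `|clamp_ball a r y - a| <= r.
Proof.
move=> r0; apply: norm_le_coord => // i; rewrite !mxE.
have : a 0 i - r <= clamp (a 0 i - r) (a 0 i + r) (y 0 i) <= a 0 i + r.
  by apply: clamp_itv; lra.
by rewrite ler_norml; lra.
Qed.

Lemma clamp_ball_id (R : realType) (N : nat) (a : 'rV[R]_N) (r : R) y :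
  `|y - a| <= r -> clamp_ball a r y = y.
Proof.
move=> ya; apply/rowP => i; rewrite !mxE; apply: clamp_id.
have := le_trans (coord_le_norm (y - a) i) ya.
by rewrite !mxE ler_norml; lra.
Qed.

Lemma clamp_ball_lipschitz (R : realType) (N : nat) (a : 'rV[R]_N) (r : R) y z :
  `|clamp_ball a r y - clamp_ball a r z| <= `|y - z|.
Proof.
apply: norm_le_coord => // i; rewrite !mxE.
apply: le_trans (clamp_lipschitz _ _ _ _) _.
by have := coord_le_norm (y - z) i; rewrite !mxE.
Qed.

(** If the curve were not defined up to [T], some time [s] of its domain would lie
    less than [tau] before the end of the domain, where [tau] is an existence time
    valid at all points of the ball. The solution issued from [x s] then prolongs the
    curve strictly; the two agree on their common domain by [solution_unique]. *)
Lemma maximal_curve_global (R : realType) (N : nat)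
    (Psi : 'rV[R]_N -> 'rV[R]_N) (a : 'rV[R]_N) (rho : R) (J : set R)
    (x : R -> 'rV[R]_N) :
  smooth Psi -> 0 < rho -> maximal_integral_curve Psi J x -> J 0 ->
  (forall t, 0 <= t -> J t -> `|x t - a| <= rho) ->
  forall t, 0 <= t -> J t.
Proof.
move=> PsiS rho0 [[openJ itvJ xPsi] Jmax] J0 xrho T T0.
have [L L0 PsiL] := locally_lipschitz a (2 * rho) PsiS.
have cPsi := smooth_continuous PsiS.
have [M M0 PsiM] : exists2 M : R, 0 <= M &
    forall y, `|y - a| <= 2 * rho -> `|Psi y| <= M.
  have cnPsi : continuous (fun y => `|Psi y|).
    by move=> y; exact: (cvg_norm (cPsi y)).
  have [M M0 MK] := bounded_above_on_compact
    (@annulus_compact R N a 0 (2 * rho)) cnPsi.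
  by exists M => // y ya; apply: MK; rewrite /= normr_ge0.
pose F y := Psi (clamp_ball a (2 * rho) y).
have rho2 : 0 <= 2 * rho by lra.
have FL y y' : `|F y - F y'| <= L * `|y - y'|.
  apply: le_trans (PsiL _ _ _ _) _; rewrite ?clamp_ball_in//.
  by rewrite ler_wpM2l// clamp_ball_lipschitz.
have FM y : `|F y| <= M by apply: PsiM; exact: clamp_ball_in.
have FPsi y : `|y - a| <= 2 * rho -> F y = Psi y.
  by move=> ya; rewrite /F clamp_ball_id.
(* The first term gives the contraction, the second keeps the new solution inside
   the ball of radius [2 * rho], where [F] and [Psi] agree. Adding 1 avoids a
   division by zero. *)
pose tau := Num.min (1 / (2 * (L + 1))) (rho / (M + 1)).
have tau0 : 0 < tau.
  by rewrite lt_min !divr_gt0 ?mulr_gt0//; apply: ltr_wpDl.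
have Ltau : L * tau <= 1 / 2.
  apply: (@le_trans _ _ (L * (1 / (2 * (L + 1))))).
    by rewrite ler_wpM2l// ge_min lexx.
  rewrite mulrA mulr1 ler_pdivrMr; last by rewrite mulr_gt0// ltr_wpDl.
  lra.
have Mtau : M * tau <= rho.
  apply: (@le_trans _ _ (M * (rho / (M + 1)))).
    by rewrite ler_wpM2l// ge_min lexx orbT.
  rewrite mulrA ler_pdivrMr; last by rewrite ltr_wpDl.
  by rewrite mulrC ler_wpM2l ?ltW// ltrDl.
apply: contrapT => nJT.
(* If every step of length [tau / 2] stayed in [J], the multiples of [tau / 2]
   would carry [J] past [T]. *)
have [s [s0 Js nJs]] : exists s, [/\ 0 <= s, J s & ~ J (s + tau / 2)].
  apply: contrapT => nos.
  have Jn n : J (n%:R * (tau / 2)).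
    elim: n => [|n ih]; first by rewrite mul0r.
    apply: contrapT => nJn; apply: nos; exists (n%:R * (tau / 2)); split=> //.
      by rewrite mulr_ge0 ?divr_ge0 ?(ltW tau0).
    by move: nJn; rewrite -natr1 mulrDl mul1r.
  apply: nJT; pose n := Num.bound (T / (tau / 2)).
  apply: (itvJ _ _ J0 (Jn n)); rewrite T0 /= -ler_pdivrMr ?divr_gt0//.
  by apply: ltW; apply: archi_boundP; rewrite !divr_ge0 ?(ltW tau0).
have [z zs zF] := picard_lindelof s (x s) FL tau0 L0 Ltau.
have xF u : 0 <= u -> J u -> is_derive u 1 x (F (x u)).
  move=> u0 Ju; rewrite FPsi; first exact: xPsi.
  by apply: le_trans (xrho _ u0 Ju) _; lra.
have xz t : s <= t -> t < s + tau -> J t -> x t = z t.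
  move=> st tst Jt.
  apply: (solution_unique FL L0 st) => //.
  - by apply: le_trans Ltau; rewrite ler_wpM2l//; lra.
  - move=> u /andP[su ut]; apply: xF; first exact: le_trans su.
    by apply: (itvJ _ _ Js Jt); rewrite su.
  - move=> u /andP[su ut]; apply: zF; rewrite ger0_norm ?subr_ge0//.
    lra.
have za t : s <= t -> t < s + tau -> `|z t - a| <= 2 * rho.
  move=> st tst.
  have : `|z t - z s| <= M * (t - s).
    apply: (@increment_norm_le R N z (fun u => F (z u))) => // u /andP[su ut].
    by apply: zF; rewrite ger0_norm ?subr_ge0//; lra.
  have : M * (t - s) <= M * tau by rewrite ler_wpM2l//; lra.
  have := xrho s s0 Js; rewrite -zs => zsa.
  have := ler_distD (z s) (z t) a; lra.
pose K := J `|` `]s, s + tau[%classic.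
(* Both pieces coincide between [s] and [s + tau], so near each point of [K] the
   map [y] equals one of the two solutions. *)
pose y t := if `[< J t >] then x t else z t.
have yx t : J t -> y t = x t by move=> Jt; rewrite /y asboolT.
have yz t : s < t -> t < s + tau -> y t = z t.
  by move=> st tst; rewrite /y; case: asboolP => // Jt; apply: xz => //; exact: ltW.
have Ky : integral_curve Psi K y.
  split.
  - by apply: openU => //; exact: interval_open.
  - move=> u v Ku Kv w /andP[uw wv].
    have [sw|ws] := ltP s w.
      case: Kv => [Jv|]; first by left; apply: (itvJ _ _ Js Jv); rewrite ltW.
      rewrite /= in_itv/= => /andP[_ vs]; right.
      by rewrite /= in_itv/= sw (le_lt_trans wv).
    left; case: Ku => [Ju|]; first by apply: (itvJ _ _ Ju Js); rewrite uw.
    by rewrite /= in_itv/= => /andP[su _]; move: ws; rewrite leNgt (lt_le_trans su).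
  - move=> t [Jt|].
      rewrite yx//; apply: (@near_eq_is_derive _ _ _ x); last exact: xPsi.
      by move: (openJ _ Jt); apply: filterS => u Ju; rewrite yx.
    rewrite /= in_itv/= => /andP[st tst]; rewrite yz//.
    apply: (@near_eq_is_derive _ _ _ z).
      have : t \in `]s, s + tau[ by rewrite in_itv/= st.
      move/near_in_itvoo; apply: filterS => u; rewrite in_itv/= => /andP[? ?].
      by rewrite yz.
    rewrite -FPsi; last by apply: za => //; exact: ltW.
    by apply: zF; rewrite ger0_norm ?subr_ge0 ?(ltW st)//; lra.
apply: nJs; apply: (Jmax K y Ky); first by left.
- by move=> t Jt; exact: yx.
- by right; rewrite /= in_itv/=; lra.
Qed.

(** * Stability and attraction *)

(** The local information about [f], [h] and [Psi] near [a] on which the whole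
    convergence argument rests. On [{h = 0}] the center is excluded, being itself critical. *)
Definition descent_ball (R : realType) (N : nat) (f h : 'rV[R]_N -> R)
    (Psi : 'rV[R]_N -> 'rV[R]_N) (a : 'rV[R]_N) (r : R) : Prop :=
  [/\ forall y, `|y - a| <= r -> h y <> 0 ->
        h y * dotp (Psi y) (gradient h y) < 0,
      forall y, 0 < `|y - a| <= r -> h y = 0 ->
        dotp (Psi y) (gradient f y) < 0 &
      forall y, 0 < `|y - a| <= r -> h y = 0 -> f a < f y].

Lemma is_derive_sqr_along_curve (R : realType) (N : nat) (h : 'rV[R]_N -> R)
    (Psi : 'rV[R]_N -> 'rV[R]_N) (J : set R) (x : R -> 'rV[R]_N) (t : R) :
  smooth h -> integral_curve Psi J x -> J t ->
  is_derive t 1 (fun u => h (x u) ^+ 2)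
    (2 * (h (x t) * dotp (Psi (x t)) (gradient h (x t)))).
Proof.
move=> hS xc Jt; have dh := is_derive_along_curve hS xc Jt.
have -> : (fun u => h (x u) ^+ 2) = (h \o x) * (h \o x).
  by apply/funext => u; rewrite !fctE expr2.
by apply: is_derive_eq; rewrite mulr_natl.
Qed.

Lemma constraint_decreases (R : realType) (N : nat) (f h : 'rV[R]_N -> R)
    (Psi : 'rV[R]_N -> 'rV[R]_N) (a : 'rV[R]_N) (r : R) (J : set R)
    (x : R -> 'rV[R]_N) (s t : R) :
  smooth h -> descent_ball f h Psi a r -> integral_curve Psi J x ->
  s <= t -> (forall u, s <= u <= t -> J u /\ `|x u - a| <= r) ->
  `|h (x t)| <= `|h (x s)|.
Proof.
move=> hS [hdec _ _] xc st xr.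
have := @increment_le R _ _ s t 0 st
  (fun u ust => is_derive_sqr_along_curve hS xc (xr u ust).1).
rewrite mul0r subr_le0 => H.
have {}H : h (x t) ^+ 2 <= h (x s) ^+ 2.
  apply: H => u ust; have [->|/eqP hu] := eqVneq (h (x u)) 0.
    by rewrite mul0r mulr0.
  by rewrite pmulr_rle0// ltW// hdec//; exact: (xr u ust).2.
move: H; rewrite -[h (x t) ^+ 2]real_normK ?num_real//.
by rewrite -[h (x s) ^+ 2]real_normK ?num_real// ler_pXn2r ?nnegrE.
Qed.

Lemma continuous_near_value (R : realType) (N : nat) (g : 'rV[R]_N -> R)
    (a : 'rV[R]_N) (e : R) :
  continuous g -> 0 < e ->
  exists2 d : R, 0 < d & forall y, `|y - a| < d -> `|g y - g a| < e.
Proof.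
move=> cg e0; have : \forall y \near a, `|g a - g y| < e.
  exact: cvgr_dist_lt (cg a) _ e0.
move=> /nbhs_ballP[d /= d0 ade]; exists d => // y ya; rewrite distrC.
by apply: ade; rewrite -ball_normE /= distrC.
Qed.

(** Since |h| does not increase, it stays so small that [f] is at least [f a + c1] on
    the sphere of radius [rho] and has a negative rate on the annulus between [d1]
    and [rho]. As [f < f a + c1 / 2] in the ball of radius [d1], the level
    [f a + c1 / 2] is a barrier that the curve cannot cross before it reaches the
    sphere. The curve may start at any time [s], because the lemma is applied again
    once a curve has come close to [a]. *)
Lemma descent_ball_stable (R : realType) (N : nat) (f h : 'rV[R]_N -> R)
    (Psi : 'rV[R]_N -> 'rV[R]_N) (a : 'rV[R]_N) (r rho : R) :
  smooth f -> smooth h -> smooth Psi -> h a = 0 -> descent_ball f h Psi a r ->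
  0 < rho -> rho <= r ->
  exists2 delta : R, 0 < delta &
    forall (J : set R) (x : R -> 'rV[R]_N) (s t : R),
      integral_curve Psi J x -> J s -> J t -> s <= t ->
      `|x s - a| < delta -> `|x t - a| < rho.
Proof.
move=> fS hS PsiS ha dball rho0 rhor; have [hdec fdec fmin] := dball.
have cPsi := smooth_continuous PsiS.
have cf := smooth_continuous fS; have ch := smooth_continuous hS.
have cnf : continuous (fun y => f a - f y).
  by move=> y; exact: (cvgB (cvg_cst _) (cf y)).
have [|c1 c10 f_sphere] :=
    uniform_negativity (@annulus_compact R N a rho rho) ch cnf.
  move=> y /= /andP[yrho rhoy] hy; rewrite subr_lt0; apply: fmin => //.
  by rewrite (lt_le_trans rho0)//= (le_trans rhoy).
have c12 : 0 < c1 / 2 by rewrite divr_gt0.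
have [d1' d1'0 f_near] := continuous_near_value a cf c12.
(* [d1 < rho] ensures that the curve starts inside the ball of radius [rho]. *)
pose d1 := Num.min d1' (rho / 2).
have d10 : 0 < d1 by rewrite lt_min d1'0 divr_gt0.
have [|c2 c20 f_annulus] := uniform_negativity (@annulus_compact R N a d1 rho)
    ch (rate_continuous fS cPsi).
  move=> y /= /andP[yd1 rhoy] hy; apply: fdec => //.
  by rewrite (lt_le_trans d10)//= (le_trans rhoy).
have c0 : 0 < Num.min c1 c2 by rewrite lt_min c10.
have [d2 d20 h_near] := continuous_near_value a ch c0.
exists (Num.min d1 d2) => [|J x s t xc Js Jt st xs]; first by rewrite lt_min d10.
have [xs1 xs2] : `|x s - a| < d1 /\ `|x s - a| < d2.
  by move: xs; rewrite lt_min => /andP[].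
have [openJ itvJ xPsi] := xc.
have Jst u : s <= u <= t -> J u by exact: (itvJ _ _ Js Jt).
have near_f y : `|y - a| < d1 -> f y < f a + c1 / 2.
  by rewrite lt_min => /andP[/f_near + _]; rewrite ltr_norml; lra.
rewrite ltNge; apply/negP => rhox.
have [u ust||T [/andP[sT Tt] xT xle]] :=
    @first_hit R (fun u => `|x u - a|) s t rho st _ _ rhox.
- apply: (@continuous_comp _ _ _ x (fun y => `|y - a|)).
    exact: curve_continuous (xPsi _ (Jst _ ust)).
  exact: dist_continuous.
- by apply: lt_trans xs1 _; rewrite gt_min ltr_pdivrMr// ltr_pMr// ltr1n orbT.
have JT u : s <= u <= T -> J u.
  by move=> /andP[su uT]; apply: Jst; rewrite su (le_trans uT).
have hsmall u : s <= u <= T -> `|h (x u)| < Num.min c1 c2.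
  move=> /andP[su uT]; apply: (@le_lt_trans _ _ `|h (x s)|).
    apply: (constraint_decreases hS dball xc su) => v /andP[sv vu].
    have svT : s <= v <= T by rewrite sv (le_trans vu).
    by split; [exact: JT|rewrite (le_trans (xle _ svT))].
  by have := h_near _ xs2; rewrite ha subr0.
have fT : f (x T) <= f a + c1 / 2.
  apply: (@barrier R (f \o x) _ s T _ sT
    (fun u usT => is_derive_along_curve fS xc (JT u usT))).
    by apply: ltW; exact: near_f.
  move=> u usT fu; have [xud|dxu] := ltP `|x u - a| d1.
    by have := near_f _ xud; rewrite ltNge fu.
  apply: (@le_trans _ _ (- c2)); last by rewrite oppr_le0 ltW.
  apply: f_annulus; first by rewrite /= dxu xle.
  by have := hsmall u usT; rewrite lt_min => /andP[].
have : f a - f (x T) <= - c1.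
  apply: f_sphere; first by rewrite /= xT lexx.
  by have := hsmall T; rewrite sT lexx lt_min => /(_ isT)/andP[].
lra.
Qed.

(** Otherwise |h| >= eta for ever, and on the compact part of the ball where this
    holds the rate of h^2 is bounded away from 0. *)
Lemma constraint_vanishes (R : realType) (N : nat) (f h : 'rV[R]_N -> R)
    (Psi : 'rV[R]_N -> 'rV[R]_N) (a : 'rV[R]_N) (r : R) (J : set R)
    (x : R -> 'rV[R]_N) (eta : R) :
  smooth h -> smooth Psi -> descent_ball f h Psi a r ->
  integral_curve Psi J x -> (forall t, 0 <= t -> J t /\ `|x t - a| <= r) ->
  0 < eta -> exists2 T : R, 0 <= T & forall t, T <= t -> `|h (x t)| < eta.
Proof.
move=> hS PsiS dball xc xr eta0; have [hdec _ _] := dball.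
have cPsi := smooth_continuous PsiS; have ch := smooth_continuous hS.
suff [T T0 hT] : exists2 T : R, 0 <= T & `|h (x T)| < eta.
  exists T => // t Tt; apply: le_lt_trans hT.
  apply: (constraint_decreases hS dball xc Tt) => u /andP[Tu _].
  by apply: xr; exact: le_trans Tu.
apply: contrapT => noT.
have hbig t : 0 <= t -> eta <= `|h (x t)|.
  by move=> t0; rewrite leNgt; apply/negP => ?; apply: noT; exists t.
(* [excess] vanishes exactly where |h| >= eta, which puts this set in the form
   required by [uniform_negativity]. *)
pose excess y := Num.min 0 (`|h y| - eta).
have cexcess : continuous excess.
  move=> y; apply: (@continuous_min R _ (cst 0) (fun z => `|h z| - eta)).
    exact: cst_continuous.
  exact: (cvgB (cvg_norm (ch y)) (cvg_cst _)).
have crate : continuous (fun y => h y * dotp (Psi y) (gradient h y)).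
  have cr := rate_continuous hS cPsi.
  by move=> y; exact: (cvgM (ch y) (cr y)).
have [|c c0 rate_le] :=
    uniform_negativity (@annulus_compact R N a 0 r) cexcess crate.
  move=> y /= /andP[_ yr] ey; apply: hdec => // hy0.
  by move: ey; rewrite /excess hy0 normr0 sub0r min_r; lra.
have c20 : 0 < 2 * c by rewrite mulr_gt0.
apply: (@no_perpetual_descent R _ _ 0 (2 * c) 0 c20
   (fun t t0 => is_derive_sqr_along_curve hS xc (xr t t0).1)) => t t0.
  rewrite -mulrN ler_wpM2l//; apply: rate_le.
    by rewrite /= normr_ge0 (xr t t0).2.
  by rewrite /excess min_l ?subr_ge0 ?hbig// normr0.
exact: sqr_ge0.
Qed.

(** Otherwise the curve remains in an annulus, on which the rate of [f] is
    bounded away from 0 as soon as |h| is small, while [f] is bounded below. *)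
Lemma descent_ball_approach (R : realType) (N : nat) (f h : 'rV[R]_N -> R)
    (Psi : 'rV[R]_N -> 'rV[R]_N) (a : 'rV[R]_N) (r : R) (J : set R)
    (x : R -> 'rV[R]_N) (delta : R) :
  smooth f -> smooth h -> smooth Psi -> descent_ball f h Psi a r ->
  integral_curve Psi J x -> (forall t, 0 <= t -> J t /\ `|x t - a| <= r) ->
  0 < delta -> exists2 T : R, 0 <= T & `|x T - a| < delta.
Proof.
move=> fS hS PsiS dball xc xr delta0; have [_ fdec _] := dball.
have cPsi := smooth_continuous PsiS; have cf := smooth_continuous fS.
apply: contrapT => noT.
have xfar t : 0 <= t -> delta <= `|x t - a|.
  by move=> t0; rewrite leNgt; apply/negP => ?; apply: noT; exists t.
have [|c c0 rate_le] := uniform_negativity (@annulus_compact R N a delta r)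
    (smooth_continuous hS) (rate_continuous fS cPsi).
  move=> y /= /andP[dy yr] hy; apply: fdec => //.
  by rewrite (lt_le_trans delta0).
have [T T0 hT] := constraint_vanishes hS PsiS dball xc xr c0.
have cnf : continuous (fun y => - f y) by move=> y; exact: (cvgN (cf y)).
have [C _ fC] := bounded_above_on_compact (@annulus_compact R N a 0 r) cnf.
have ge0 t : T <= t -> 0 <= t by exact: le_trans.
apply: (@no_perpetual_descent R _ _ T c (- C) c0
   (fun t Tt => is_derive_along_curve fS xc (xr t (ge0 t Tt)).1)) => t Tt.
  apply: rate_le; last exact: hT.
  by rewrite /= xfar ?ge0// (xr t _).2// ge0.
by rewrite lerNl; apply: fC; rewrite /= normr_ge0 (xr t _).2// ge0.
Qed.

Lemma descent_ball_attractive (R : realType) (N : nat) (f h : 'rV[R]_N -> R)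
    (Psi : 'rV[R]_N -> 'rV[R]_N) (a : 'rV[R]_N) (r : R) :
  smooth f -> smooth h -> smooth Psi -> h a = 0 -> descent_ball f h Psi a r ->
  0 < r ->
  exists2 delta : R, 0 < delta &
    forall (J : set R) (x : R -> 'rV[R]_N),
      maximal_integral_curve Psi J x -> J 0 -> `|x 0 - a| < delta ->
      (forall t, 0 <= t -> J t) /\ x t @[t --> +oo] --> a.
Proof.
move=> fS hS PsiS ha dball r0.
have [delta delta0 stay] :=
  descent_ball_stable fS hS PsiS ha dball r0 (lexx r).
exists delta => // J x xmax J0 x0.
have xc : integral_curve Psi J x by case: xmax.
have Jge0 : forall t, 0 <= t -> J t.
  apply: (maximal_curve_global PsiS r0 xmax J0 (a := a)) => t t0 Jt.
  by apply: ltW; exact: (stay _ _ _ _ xc J0 Jt t0 x0).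
split=> //.
have xr t : 0 <= t -> J t /\ `|x t - a| <= r.
  move=> t0; split; first exact: Jge0.
  by apply: ltW; exact: (stay _ _ _ _ xc J0 (Jge0 _ t0) t0 x0).
apply/cvgrPdist_lt => e e0.
pose rho := Num.min e r.
have rho0 : 0 < rho by rewrite lt_min e0.
have rhor : rho <= r by rewrite ge_min lexx orbT.
have [d d0 stay_rho] := descent_ball_stable fS hS PsiS ha dball rho0 rhor.
have [T T0 xT] := descent_ball_approach fS hS PsiS dball xc xr d0.
near=> t; have Tt : T <= t by near: t; apply: nbhs_pinfty_ge; exact: num_real.
rewrite distrC; apply: (@lt_le_trans _ _ rho); last by rewrite ge_min lexx.
by apply: (stay_rho J x T t xc) => //; apply: Jge0 => //; exact: le_trans Tt.
Unshelve. all: by end_near. Qed.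

(** A nonzero combination of grad f and grad h that vanishes has a nonzero
    coefficient on grad f, since grad h <> 0; this turns parallelism into the
    optimality system. A point of the ball with the value [f a] is itself a local
    solution, since [a] is minimal on the whole ball. *)
Lemma isolated_solution_descent_ball (R : realType) (N : nat)
    (f h : 'rV[R]_N -> R) (Psi : 'rV[R]_N -> 'rV[R]_N) (a : 'rV[R]_N) :
  (forall x, h x = 0 -> gradient h x <> 0) ->
  isolated_solution f h a ->
  (exists U : set 'rV[R]_N,
     [/\ open U, [set x | h x = 0] `<=` U &
         forall x, U x -> h x <> 0 -> h x * dotp (Psi x) (gradient h x) < 0]) ->
  (forall x, h x = 0 -> dotp (Psi x) (gradient f x) <= 0) ->
  (forall x, dotp (Psi x) (gradient f x) = 0 -> h x = 0 ->
     parallel (gradient f x) (gradient h x)) ->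
  exists2 r : R, 0 < r & descent_ball f h Psi a r.
Proof.
move=> hreg [[ha amin] _ aisol] [U [openU hU UPsi]] Psif Psipar.
have nbhsU : \forall y \near a, U y by apply: open_nbhs_nbhs; split=> //; exact: hU.
have {}aisol : \forall y \near a, y != a ->
    ~ local_solution f h y /\ ~ optimality_system f h y.
  exact: aisol.
have [e /= e0 ae] := (nbhs_ballP _ _).1 (filterI nbhsU (filterI aisol amin)).
exists (e / 2); first by rewrite divr_gt0.
have near_a y : `|y - a| <= e / 2 -> ball a e y.
  move=> ya; rewrite -ball_normE /= distrC (le_lt_trans ya)//.
  by rewrite ltr_pdivrMr// ltr_pMr// ltr1n.
have neq_a y : 0 < `|y - a| -> y != a by rewrite normr_gt0 subr_eq0.
split=> y.
- by move=> /near_a/ae[Uy _]; exact: UPsi.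
- move=> /andP[/neq_a ya /near_a/ae[_ [/(_ ya)[_ nopt] _]]] hy.
  rewrite lt_neqAle Psif// andbT; apply/eqP => Psify0; apply: nopt; split=> //.
  have [c [d [cd0 cd]]] := Psipar y Psify0 hy.
  have [c0|c0] := eqVneq c 0.
    have d0 : d != 0 by apply/eqP => d0; apply: cd0; rewrite c0 d0.
    exfalso; apply: (hreg y hy); apply/eqP.
    by move: cd => /eqP; rewrite c0 scale0r add0r scaler_eq0 (negbTE d0).
  exists (d / c); apply: (scalerI c0); rewrite scaler0 -[RHS]cd scalerDr scalerA.
  by rewrite mulrCA divff// mulr1.
- move=> /andP[/neq_a ya yr] hy; have yball := near_a _ yr.
  have [_ [/(_ ya)[nloc _] /(_ hy) fay]] := ae _ yball.
  rewrite lt_neqAle fay andbT; apply/eqP => fE; apply: nloc; split=> //.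
  have : nbhs y (ball a e) by apply: open_nbhs_nbhs; split=> //; exact: ball_open.
  by apply: filterS => w /ae[_ [_ wmin]] hw; rewrite -fE; exact: wmin.
Qed.

Theorem lemma1p1 (R : realType) (N : nat) (f h : 'rV[R]_N -> R)
  (Psi : 'rV[R]_N -> 'rV[R]_N) (xbar : 'rV[R]_N)
  (f_smooth : smooth f) (h_smooth : smooth h)
  (h_regular : forall x, h x = 0 -> gradient h x <> 0)
  (xbar_isolated : isolated_solution f h xbar)
  (Psi_smooth : smooth Psi)
  (Psi_equilibria : isolated_equilibria Psi)
  (Psi_h : exists U : set 'rV[R]_N,
     [/\ open U, [set x | h x = 0] `<=` U &
         forall x, U x -> h x <> 0 -> h x * dotp (Psi x) (gradient h x) < 0])
  (Psi_f : forall x, h x = 0 -> dotp (Psi x) (gradient f x) <= 0)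
  (Psi_parallel : forall x, dotp (Psi x) (gradient f x) = 0 -> h x = 0 ->
     parallel (gradient f x) (gradient h x)) :
  exists2 delta : R, 0 < delta &
    forall (J : set R) (x : R -> 'rV[R]_N),
      maximal_integral_curve Psi J x -> J 0 -> `|x 0 - xbar| < delta ->
      (forall t, 0 <= t -> J t) /\ x t @[t --> +oo] --> xbar.
Proof.
have [r r0 dball] := isolated_solution_descent_ball h_regular xbar_isolated
  Psi_h Psi_f Psi_parallel.
have [[hx _] _ _] := xbar_isolated.
exact: descent_ball_attractive f_smooth h_smooth Psi_smooth hx dball r0.
Qed.
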